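(* Let $KB=(\emptyset,\Pi)$ be a normal logic program. Then the well-founded semantics of $KB$ (as an FOL-program), i.e. $\mathrm{lfp}(W_{KB})$, coincides with the standard well-founded semantics of the normal program $\Pi$, i.e. $\mathrm{lfp}(W_\Pi)$.
   Context: **Language.** Fix a decidable fragment of first-order logic over a signature with function symbols $F^n$ and predicate symbols $P^n$ (constants are $0$-ary functions). Let $\Phi_P$ be a finite set of predicate symbols and $\Phi_C$ a nonempty finite set of constants with $\Phi_C\subseteq F^n$; $\Phi_P$ and $P^n$ may share symbols. An atom is $P(t_1,\dots,t_n)$ with $P\in\Phi_P$ and each $t_i$ a constant of $\Phi_C$ or a variable. An FOL-program is $KB=(L,\Pi)$, where $L$ is a first-order theory of the fragment and $\Pi$ is a finite set of rules $H\leftarrow A_1,\dots,A_m,\mathit{not}\,B_1,\dots,\mathit{not}\,B_n$ with $H$ an atom and each $A_i,B_j$ an atom or a first-order formula. Rules are assumed ground (free variables replaced by constants of $\Phi_C$), and all atoms and formulas are ground. For such a rule $r$: $head(r)=H$, $pos(r)=\{A_1,\dots,A_m\}$, $neg(r)=\{B_1,\dots,B_n\}$. $HB_\Pi$ is the set of ground atoms $P(t_1,\dots,t_n)$ with $P\in\Phi_P$ occurring in $KB$ and $t_i\in\Phi_C$. $\Omega$ is the set of predicate symbols appearing in $HB_\Pi$ that belong to $P^n$. Atoms whose predicate is not in $\Omega$ are called ordinary; all other formulas are called FOL-formulas. $KB=(L,\Pi)$ is a normal logic program if $L=\emptyset$ and in all rules of $\Pi$ all $H,A_i,B_j$ are ordinary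 atoms. For a set $Q$ of atoms, $\neg.Q=\{\neg A\mid A\in Q\}$. $Lit_\Pi=HB_\Pi\cup\neg.HB_\Pi$. A set $S\subseteq Lit_\Pi$ is consistent if there is no atom $A$ with both $A\in S$ and $\neg A\in S$. $S|_\Omega$ is the set of elements of $S$ (atoms or negated atoms) whose predicate symbol is in $\Omega$. $Lit_\Pi^c$ is the set of all consistent subsets of $Lit_\Pi$. For $I\subseteq Lit_\Pi$, ''$I\cup L$ is consistent'' means that $I$ is consistent and the first-order theory $L\cup I|_\Omega$ is satisfiable. $\models$ is classical first-order entailment. **Unfounded sets.** Let $I\subseteq Lit_\Pi$. If $I\cup L$ is consistent, $U\subseteq HB_\Pi$ is an unfounded set of $KB$ relative to $I$ iff for every $H\in U$ and $r\in\Pi$ both hold: (a) if $head(r)=H$, then (i) $\neg A\in I\cup\neg.U$ for some ordinary atom $A\in pos(r)$, or (ii) $B\in I$ for some ordinary atom $B\in neg(r)$, or (iii) for some FOL-formula $A\in pos(r)$, $L\cup S|_\Omega\not\models A$ for all $S\in Lit_\Pi^c$ with $I\cup\neg.U\subseteq S$, or (iv) for some FOL-formula $A\in neg(r)$, $L\cup I|_\Omega\models A$; (b) $L\cup S|_\Omega\not\models H$ for all $S\in Lit_\Pi^c$ with $I\cup\neg.U\subseteq S$. If $I\cup L$ is inconsistent, the unfounded set of $KB$ relative to $I$ is $HB_\Pi$. **Operators.** For $I\subseteq Lit_\Pi$: - $T_{KB}(I)=HB_\Pi$ if $I\cup L$ is inconsistent. Otherwise $H\in T_{KB}(I)$ iff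 $H\in HB_\Pi$ and either (a) there is $r\in\Pi$ with $head(r)=H$ such that (1) for any ordinary atom $A$, $A\in I$ if $A\in pos(r)$ and $\neg A\in I$ if $A\in neg(r)$, (2) $L\cup I|_\Omega\models A$ for any FOL-formula $A\in pos(r)$, and (3) for any FOL-formula $B\in neg(r)$, $L\cup S|_\Omega\not\models B$ for all $S\in Lit_\Pi^c$ with $I\subseteq S$; or (b) $L\cup I|_\Omega\models H$. - $U_{KB}(I)$ is the greatest unfounded set of $KB$ relative to $I$. - $Z_{KB}(I)=\{A\in HB_\Pi\mid L\cup I|_\Omega\models\neg A\}$. - $W_{KB}(I)=T_{KB}(I)\cup\neg.U_{KB}(I)\cup\neg.Z_{KB}(I)$. $W_{KB}$ is monotone on $\langle 2^{Lit_\Pi},\subseteq\rangle$, and the well-founded semantics of $KB$ is its least fixpoint $\mathrm{lfp}(W_{KB})$. **Standard well-founded semantics of a normal program $\Pi$.** It is the least fixpoint of the monotone operator $W_\Pi(S)=T_\Pi(S)\cup\neg.U_\Pi(S)$ on consistent subsets $S$ of $HB_\Pi\cup\neg.HB_\Pi$, where $T_\Pi(S)=\{head(r)\mid r\in\Pi,\ pos(r)\cup\neg.neg(r)\subseteq S\}$ and $U_\Pi(S)$ is the greatest unfounded set of $\Pi$ w.r.t. $S$. Here $U\subseteq HB_\Pi$ is an unfounded set of $\Pi$ w.r.t. $S$ if for every $a\in U$ and every $r\in\Pi$ with $head(r)=a$, either $\neg b\in S\cup\neg.U$ for some $b\in pos(r)$, or $b\in S$ for some $b\in neg(r)$. *)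

(* Defs.v *)
From mathcomp Require Import all_boot.
From mathcomp Require Import boolp classical_sets cardinality.

Set Implicit Arguments.
Unset Strict Implicit.
Unset Printing Implicit Defensive.

Local Open Scope classical_set_scope.

Section Order.
Variable T : Type.

Definition is_lfp_on (D : set (set T)) (F : set T -> set T) (X : set T) : Prop :=
  [/\ D X, F X = X & forall Y, D Y -> F Y = Y -> X `<=` Y].

Definition is_greatest (P : set (set T)) (X : set T) : Prop :=
  P X /\ forall Y, P Y -> Y `<=` X.

Lemma is_lfp_on_uniq D F X Y : is_lfp_on D F X -> is_lfp_on D F Y -> X = Y.
Proof. by move=> [DX FX lX] [DY FY lY]; apply/seteqP; split; [exact: lX|exact: lY]. Qed.

End Order.

(* Decidability is meant in the sense of computability theory (a bool-valued
   decision function would exist for every predicate by classical choice).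
   The model is Minsky's register machine with unboundedly many registers.
   [Dec r l] jumps to instruction l when register r is 0. *)
Inductive instr := Inc of nat | Dec of nat & nat.

Definition upd (D : Type) (e : nat -> D) (x : nat) (a : D) : nat -> D :=
  fun y => if y == x then a else e y.

Definition config := (nat * (nat -> nat))%type.

Definition rm_step (p : seq instr) (c : config) : config :=
  let: (pc, s) := c in
  match onth p pc with
  | None => c
  | Some (Inc r) => (pc.+1, upd s r (s r).+1)
  | Some (Dec r l) => if s r == 0 then (l, s) else (pc.+1, upd s r (s r).-1)
  end.

Definition rm_init (n : nat) : config := (0, upd (fun=> 0) 0 n).

(* On every input in D the machine halts, with a nonzero value in register 0
   exactly when the input satisfies P; D is a promise on the inputs. *)
Definition decidable_on (D P : set nat) : Prop :=
  exists p : seq instr, forall n, D n ->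
    exists k : nat, let: (pc, s) := iter k (rm_step p) (rm_init n) in
      size p <= pc /\ (s 0 <> 0 <-> P n).

(* Symbols are countable so that formulas have Gödel numbers.  [psym] contains
   the predicate symbols of the first-order language, singled out by [fol_psym],
   as well as the additional ones that only programs may use; a structure
   interprets all of them, so that entailment makes sense for every atom. *)
Record signature := Signature {
  fsym : countType;
  farity : fsym -> nat;
  psym : countType;
  parity : psym -> nat;
  fol_psym : set psym }.

Section FirstOrderLogic.
Variable Sg : signature.

Inductive term :=
  | Var of nat
  | App (f : fsym Sg) of 'I_(farity f) -> term.

Inductive formula :=
  | Atom (P : psym Sg) of 'I_(parity P) -> term
  | Eql of term & term
  | Not of formula
  | And of formula & formula
  | Or of formula & formula
  | Imp of formula & formula
  | All of nat & formula
  | Ex of nat & formula.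

Fixpoint term_var (t : term) : set nat :=
  match t with
  | Var x => [set x]
  | App f ts => [set x | exists i, term_var (ts i) x]
  end.

Fixpoint free_var (A : formula) : set nat :=
  match A with
  | Atom P ts => [set x | exists i, term_var (ts i) x]
  | Eql t u => term_var t `|` term_var u
  | Not A => free_var A
  | And A B | Or A B | Imp A B => free_var A `|` free_var B
  | All x A | Ex x A => free_var A `\ x
  end.

Definition sentence (A : formula) : Prop := free_var A = set0.

Fixpoint pred_occ (A : formula) : set (psym Sg) :=
  match A with
  | Atom P ts => [set P]
  | Eql t u => set0
  | Not A | All _ A | Ex _ A => pred_occ A
  | And A B | Or A B | Imp A B => pred_occ A `|` pred_occ B
  end.

Record structure := Structure {
  dom : Type;
  dom_inhabited : inhabited dom;
  fint : forall f : fsym Sg, ('I_(farity f) -> dom) -> dom;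
  pint : forall P : psym Sg, ('I_(parity P) -> dom) -> Prop }.

Fixpoint teval (M : structure) (e : nat -> dom M) (t : term) : dom M :=
  match t with
  | Var x => e x
  | App f ts => fint (fun i => teval e (ts i))
  end.

Fixpoint sat (M : structure) (e : nat -> dom M) (A : formula) : Prop :=
  match A with
  | Atom P ts => pint (fun i => teval e (ts i))
  | Eql t u => teval e t = teval e u
  | Not A => ~ sat e A
  | And A B => sat e A /\ sat e B
  | Or A B => sat e A \/ sat e B
  | Imp A B => sat e A -> sat e B
  | All x A => forall a, sat (upd e x a) A
  | Ex x A => exists a, sat (upd e x a) A
  end.

Definition models (M : structure) (A : formula) : Prop :=
  forall e : nat -> dom M, sat e A.

Definition satisfiable (L : set formula) : Prop :=
  exists M : structure, forall A, L A -> models M A.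

Definition entails (L : set formula) (A : formula) : Prop :=
  forall M : structure, (forall B, L B -> models M B) -> models M A.

Fixpoint term_code (t : term) : nat :=
  match t with
  | Var x => CodeSeq.code [:: 0; x]
  | App f ts =>
      CodeSeq.code [:: 1, pickle f & [seq term_code (ts i) | i <- enum 'I_(farity f)]]
  end.

Fixpoint formula_code (A : formula) : nat :=
  match A with
  | Atom P ts =>
      CodeSeq.code [:: 0, pickle P & [seq term_code (ts i) | i <- enum 'I_(parity P)]]
  | Eql t u => CodeSeq.code [:: 1; term_code t; term_code u]
  | Not A => CodeSeq.code [:: 2; formula_code A]
  | And A B => CodeSeq.code [:: 3; formula_code A; formula_code B]
  | Or A B => CodeSeq.code [:: 4; formula_code A; formula_code B]
  | Imp A B => CodeSeq.code [:: 5; formula_code A; formula_code B]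
  | All x A => CodeSeq.code [:: 6; x; formula_code A]
  | Ex x A => CodeSeq.code [:: 7; x; formula_code A]
  end.

Lemma term_code_inj : injective term_code.
Proof.
elim=> [x|f ts IH] [y|g us] /(can_inj CodeSeq.codeK) //.
  by case=> ->.
case=> /(pcan_inj pickleK) fg; case: _ / fg us => us H.
congr App; apply/funext => i; apply: IH.
by move/eq_in_map: H; apply; rewrite mem_enum.
Qed.

Lemma formula_code_inj : injective formula_code.
Proof.
elim=> [P ts|t u|A IA|A IA B IB|A IA B IB|A IA B IB|x A IA|x A IA]
       [Q us|t' u'|A'|A' B'|A' B'|A' B'|y A'|y A'] /(can_inj CodeSeq.codeK) //.
- case=> /(pcan_inj pickleK) PQ; case: _ / PQ us => us H.
  congr Atom; apply/funext => i; apply: term_code_inj.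
  by move/eq_in_map: H; apply; rewrite mem_enum.
- by case=> /term_code_inj -> /term_code_inj ->.
- by case=> /IA ->.
- by case=> /IA -> /IB ->.
- by case=> /IA -> /IB ->.
- by case=> /IA -> /IB ->.
- by case=> -> /IA ->.
- by case=> -> /IA ->.
Qed.

Definition decidable_fragment (F : set formula) : Prop :=
  decidable_on (formula_code @` F)
               (formula_code @` [set A | satisfiable [set A]]).

Definition negs (Q : set formula) : set formula := Not @` Q.

Definition is_atom (A : formula) : Prop := exists P ts, A = @Atom P ts.

Definition consistent (S : set formula) : Prop :=
  ~ exists A, [/\ is_atom A, S A & S (Not A)].

Record rule := Rule {
  rhead : formula;
  pos : set formula;
  neg : set formula }.

(* The standard well-founded semantics of a normal program Pi with Herbrand
   base HB. *)
Section Standard.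
Variables (HB : set formula) (Pi : set rule).

Definition std_T (S : set formula) : set formula :=
  [set rhead r | r in [set r | Pi r /\ pos r `|` negs (neg r) `<=` S]].

Definition std_unfounded (S U : set formula) : Prop :=
  U `<=` HB /\
  forall a r, U a -> Pi r -> rhead r = a ->
    (exists2 b, pos r b & (S `|` negs U) (Not b)) \/
    (exists2 b, neg r b & S b).

Definition std_U (S : set formula) : set formula :=
  \bigcup_(U in std_unfounded S) U.

Lemma std_U_greatest S : is_greatest (std_unfounded S) (std_U S).
Proof.
split=> [|Y uY]; last exact: bigcup_sup.
split=> [A [U [UH _] /UH//]|a r [U uU Ua] Pr hr].
have [[b pb Ib]|] := uU.2 _ _ Ua Pr hr; last by right.
left; exists b => //; case: Ib => [|[c Uc cb]]; first by left.
by right; exists c => //; exists U.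
Qed.

Definition std_W (S : set formula) : set formula := std_T S `|` negs (std_U S).

Definition std_wfs (W : set formula) : Prop :=
  is_lfp_on [set S | S `<=` HB `|` negs HB /\ consistent S] std_W W.

End Standard.

End FirstOrderLogic.

Record language := Language {
  lsig :> signature;
  Phi_P : set (psym lsig);
  Phi_C : set (fsym lsig);
  fragment : set (formula lsig);
  Phi_P_finite : finite_set Phi_P;
  Phi_C_finite : finite_set Phi_C;
  Phi_C_nonempty : Phi_C !=set0;
  Phi_C_constant : forall c, Phi_C c -> farity c = 0;
  fragment_sentence : forall A, fragment A -> sentence A;
  fragment_fol : forall A, fragment A -> pred_occ A `<=` @fol_psym lsig;
  fragment_decidable : decidable_fragment fragment }.

Definition ground_atom (Lg : language) (A : formula Lg) : Prop :=
  exists (P : psym Lg) (ts : 'I_(parity P) -> term Lg),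
    [/\ A = Atom ts, Phi_P P &
        forall i, exists (c : fsym Lg) us, Phi_C c /\ ts i = @App Lg c us].

Record fol_program (Lg : language) := FOLProgram {
  theory : set (formula Lg);
  rules : set (rule Lg);
  theory_fragment : theory `<=` @fragment Lg;
  rules_finite : finite_set rules;
  pos_finite : forall r, rules r -> finite_set (pos r);
  neg_finite : forall r, rules r -> finite_set (neg r);
  head_atom : forall r, rules r -> ground_atom (rhead r);
  body_wf : forall r A, rules r -> (pos r `|` neg r) A ->
    ground_atom A \/ fragment A }.

Section Program.
Variables (Lg : language) (KB : fol_program Lg).

Local Notation fset := (set (formula Lg)).
Local Notation L := (theory KB).
Local Notation Pi := (rules KB).

Definition pred_occurs (P : psym Lg) : Prop :=
  (exists2 A, L A & pred_occ A P) \/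
  (exists2 r, Pi r & exists2 A, ([set rhead r] `|` pos r `|` neg r) A & pred_occ A P).

Definition HB : fset :=
  [set A | ground_atom A /\ forall P, pred_occ A P -> pred_occurs P].

Definition Omega : set (psym Lg) :=
  [set P | fol_psym P /\ exists2 A, HB A & pred_occ A P].

Definition ordinary (A : formula Lg) : Prop :=
  ground_atom A /\ forall P, pred_occ A P -> ~ Omega P.

Definition fol_formula (A : formula Lg) : Prop := ~ ordinary A.

Definition normal_program : Prop :=
  L = set0 /\
  forall r, Pi r -> ordinary (rhead r) /\ forall A, (pos r `|` neg r) A -> ordinary A.

Definition Lit : fset := HB `|` negs HB.

Definition LitC : set fset := [set S | S `<=` Lit /\ consistent S].

(* For use on sets of literals: a literal has exactly one predicate symbol. *)
Definition restr (S : fset) : fset := [set l | S l /\ pred_occ l `<=` Omega].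

Definition KB_entails (S : fset) (A : formula Lg) : Prop :=
  entails (L `|` restr S) A.

Definition KB_consistent (I : fset) : Prop :=
  consistent I /\ satisfiable (L `|` restr I).

Definition unfounded (I U : fset) : Prop :=
  (KB_consistent I ->
     U `<=` HB /\
     forall H r, U H -> Pi r ->
       (rhead r = H ->
          [\/ exists A, [/\ ordinary A, pos r A & (I `|` negs U) (Not A)],
              exists B, [/\ ordinary B, neg r B & I B],
              exists A, [/\ fol_formula A, pos r A &
                forall S, LitC S -> I `|` negs U `<=` S -> ~ KB_entails S A] |
              exists A, [/\ fol_formula A, neg r A & KB_entails I A]]) /\
       (forall S, LitC S -> I `|` negs U `<=` S -> ~ KB_entails S H)) /\
  (~ KB_consistent I -> U = HB).

Definition U_KB (I : fset) : fset := \bigcup_(U in unfounded I) U.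

Lemma U_KB_greatest I : is_greatest (unfounded I) (U_KB I).
Proof.
split=> [|Y uY]; last exact: bigcup_sup.
have sub U : unfounded I U -> I `|` negs U `<=` I `|` negs (U_KB I).
  move=> uU A [|[B UB <-]]; first by left.
  by right; exists B => //; exists U.
split=> [cI|nI].
  split=> [A [U [/(_ cI)[UH _] _] /UH//]|H r [U uU UH] Pr].
  have [/(_ cI)[_ /(_ _ _ UH Pr)[Ua Ub]] _] := uU.
  split=> [/Ua|S cS IS]; last by apply: Ub => //; exact: subset_trans (sub _ uU) IS.
  case=> [[A [oA pA IA]]|?|[A [fA pA IA]]|?]; [apply: Or41|exact: Or42|apply: Or43|exact: Or44].
    by exists A; split => //; exact: sub IA.
  exists A; split => // S cS IS; apply: IA => //; exact: subset_trans (sub _ uU) IS.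
apply/seteqP; split=> [A [U [_ /(_ nI)->]]//|A HA].
by exists HB => //; split.
Qed.

Definition T_KB (I : fset) : fset :=
  [set H | HB H /\
    (KB_consistent I ->
       (exists r, [/\ Pi r, rhead r = H,
          forall A, ordinary A -> (pos r A -> I A) /\ (neg r A -> I (Not A)),
          forall A, fol_formula A -> pos r A -> KB_entails I A &
          forall B, fol_formula B -> neg r B ->
            forall S, LitC S -> I `<=` S -> ~ KB_entails S B]) \/
       KB_entails I H)].

Definition Z_KB (I : fset) : fset := [set A | HB A /\ KB_entails I (Not A)].

Definition W_KB (I : fset) : fset :=
  T_KB I `|` negs (U_KB I) `|` negs (Z_KB I).

Definition wfs (W : fset) : Prop := is_lfp_on [set I | I `<=` Lit] W_KB W.

End Program.

(* Main.v *)
Require Import Defs.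
From mathcomp Require Import all_boot.
From mathcomp Require Import boolp classical_sets.

(** In a normal program every predicate of the Herbrand base occurs in an
    ordinary atom, so Omega is empty and every entailment test in the operator
    W_KB is one from the empty theory, which entails no literal.  Hence W_KB
    agrees with the standard operator W on consistent sets, and it sends an
    inconsistent set to the set of all literals.  The point is therefore that the
    least fixpoint X of W on arbitrary sets of literals is consistent.  Let X' be
    the consistent part of X, that is, X with all complementary pairs removed.
    The set obtained from X by removing the greatest unfounded set relative to X'
    is closed under W, so it is all of X; with this, X' itself is closed under
    W, so X = X'. *)

Set Implicit Arguments.
Unset Strict Implicit.
Unset Printing Implicit Defensive.

Local Open Scope classical_set_scope.

(** Knaster-Tarski. Minimality is stated against all sets closed under [F], not only fixpoints,
    because the consistency argument tests it on sets that are merely closed. *)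
Lemma exists_lfp_on_setT (T : Type) (F : set T -> set T) :
  {homo F : A B / A `<=` B} ->
  exists X, F X = X /\ forall Y, F Y `<=` Y -> X `<=` Y.
Proof.
move=> homoF; pose X := \bigcap_(Y in [set Y | F Y `<=` Y]) Y.
have minX Y : F Y `<=` Y -> X `<=` Y by move=> FY; exact: bigcap_inf.
have FX : F X `<=` X.
  by apply: sub_bigcap => Y /= FY; exact: subset_trans (homoF _ _ (minX Y FY)) FY.
by exists X; split=> //; apply/seteqP; split=> //; apply: minX; exact: homoF.
Qed.

Section StandardOperator.
Variables (Sg : signature) (HB : set (formula Sg)) (Pi : set (rule Sg)).
Implicit Types S U X : set (formula Sg).

Lemma std_T_homo : {homo std_T Pi : S S' / S `<=` S'}.
Proof.
move=> S S' SS' A [r [Pr rS] <-]; exists r => //.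
by split=> //; exact: subset_trans SS'.
Qed.

Lemma std_unfoundedS S S' U :
  S `<=` S' -> std_unfounded HB Pi S U -> std_unfounded HB Pi S' U.
Proof.
move=> SS' [UH uU]; split=> // a r Ua Pr hr.
have [[b pb Ib]|[b nb Sb]] := uU _ _ Ua Pr hr; last by right; exists b => //; exact: SS'.
by left; exists b => //; exact: setSU Ib.
Qed.

Lemma std_U_homo : {homo std_U HB Pi : S S' / S `<=` S'}.
Proof. by move=> S S' SS' A [U uU UA]; exists U => //; exact: std_unfoundedS uU. Qed.

Lemma std_W_homo : {homo std_W HB Pi : S S' / S `<=` S'}.
Proof.
move=> S S' SS'; apply: setUSS; first exact: std_T_homo.
exact/image_subset/std_U_homo.
Qed.

Lemma std_U_sub S : std_U HB Pi S `<=` HB.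
Proof. by have [[]] := std_U_greatest HB Pi S. Qed.

Hypothesis HB_atom : HB `<=` @is_atom Sg.
Hypothesis head_HB : forall r, Pi r -> HB (rhead r).

Lemma HB_Not A : ~ HB (Not A).
Proof. by case/HB_atom => P [ts]. Qed.

Lemma std_T_sub S : std_T Pi S `<=` HB.
Proof. by move=> A [r [Pr _] <-]; exact: head_HB. Qed.

Lemma std_W_sub S : std_W HB Pi S `<=` HB `|` negs HB.
Proof. by apply: setUSS; [exact: std_T_sub|apply: image_subset; exact: std_U_sub]. Qed.

Lemma std_W_Not S A : std_W HB Pi S (Not A) -> std_U HB Pi S A.
Proof. by case=> [/std_T_sub/HB_Not//|[B UB [<-]]]. Qed.

Lemma std_lfp_consistent X :
  std_W HB Pi X = X -> (forall Y, std_W HB Pi Y `<=` Y -> X `<=` Y) -> consistent X.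
Proof.
move=> WX minX.
pose X' := [set l | [/\ X l, ~ X (Not l) & forall A, l = Not A -> ~ X A]].
have X'X : X' `<=` X by move=> l [].
have [[_ uX'] _] := std_U_greatest HB Pi X'.
have [[_ uX] _] := std_U_greatest HB Pi X.
pose Y := X `\` std_U HB Pi X'.
have XY : X `<=` Y.
  apply: minX => l Wl; split; first by rewrite -WX; apply: std_W_homo Wl => ? [].
  (* A rule with body true in [Y] cannot have its head unfounded relative to [X']. A negative
     witness [b] would be in [X'] with [Not b] in [X]. A positive witness [b] is in [Y], so [b] is
     not unfounded, and [b] in [X] keeps [Not b] out of [X']. *)
  case: Wl => [[r [Pr rY] <-] Ur|[a Ua <-] /std_U_sub/HB_Not//].
  have [[b pb]|[b nb [_ nXb _]]] := uX' _ _ Ur Pr erefl; last first.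
    by have [] : Y (Not b) by apply: rY; right; exists b.
  have [Xb nUb] : Y b by apply: rY; left.
  by case=> [[_ _ /(_ b erefl)]//|[c Uc [cb]]]; apply: nUb; rewrite -cb.
have XX' : X `<=` X'.
  apply: minX => l Wl; have Xl : X l by rewrite -WX; exact: std_W_homo Wl.
  (* For [l = Not a], the inclusion of [X] in [Y] keeps [a] out of [X], and a double negation is
     never a literal. *)
  case: Wl => [[r [Pr rX'] hr]|[a Ua al]]; last first.
    split=> // [|A]; last by rewrite -al => -[<-] /XY[].
    by rewrite -WX => /std_W_Not/std_U_sub; rewrite -al => /HB_Not.
  split=> // [|A lA]; last by case: (@HB_Not A); rewrite -lA -hr; exact: head_HB.
  (* If [Not l] were in [X], then [l] would be unfounded relative to the fixpoint [X], so [X] would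
     contain the complement of some body literal of [r]. But these literals lie in [X']. *)
  rewrite -WX => /std_W_Not Ul.
  have [[b pb XUb]|[b nb Xb]] := uX _ _ Ul Pr hr; last first.
    have [_ _ /(_ b erefl)//] : X' (Not b) by apply: rX'; right; exists b.
  have [_ nXb _] : X' b by apply: rX'; left.
  by apply: nXb; case: XUb => // Ub; rewrite -WX; right.
by move=> [A [_ /XX'[_ nXA _] XA]].
Qed.

End StandardOperator.

Section ConstantInterpretation.
Variable Sg : signature.

(** All atoms get the same truth value [p], so [False] refutes every atom and [True] every negated
    atom. *)
Let unit_structure (p : Prop) : structure Sg :=
  @Structure Sg unit (inhabits tt) (fun _ _ => tt) (fun _ _ => p).

Lemma satisfiable0 : satisfiable (@set0 (formula Sg)).
Proof. by exists (unit_structure True). Qed.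

Lemma not_entails0_atom (A : formula Sg) : is_atom A -> ~ entails set0 A.
Proof.
by move=> [P [ts ->]] /(_ (unit_structure False)); apply=> // x; exact: tt.
Qed.

Lemma not_entails0_Not_atom (A : formula Sg) : is_atom A -> ~ entails set0 (Not A).
Proof.
by move=> [P [ts ->]] /(_ (unit_structure True)) H; apply: (H _ (fun=> tt)).
Qed.

End ConstantInterpretation.

Section NormalProgram.
Variables (Lg : language) (KB : fol_program Lg).
Hypothesis KB_normal : normal_program KB.
Implicit Types I S U : set (formula Lg).

Lemma ground_is_atom (A : formula Lg) : ground_atom A -> is_atom A.
Proof. by move=> [P [ts [-> _ _]]]; exists P, ts. Qed.

Lemma HB_is_atom : HB KB `<=` @is_atom Lg.
Proof. by move=> A [/ground_is_atom]. Qed.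

Lemma head_HB r : rules KB r -> HB KB (rhead r).
Proof.
move=> Pr; split=> [|P AP]; first exact: head_atom Pr.
by right; exists r => //; exists (rhead r) => //; do 2 left.
Qed.

Lemma normal_Omega : Omega KB = set0.
Proof.
apply/seteqP; split=> // P OP; have [_ [A [_ occA] /occA AP]] := OP.
have [L0 ord] := KB_normal.
case: AP => [[B]|[r Pr [B rB BP]]]; first by rewrite L0.
have [oh ob] := ord _ Pr.
have [_ nO] : ordinary KB B by case: rB => [[->//|pB]|nB]; apply: ob; [left|right].
exact: nO OP.
Qed.

Lemma normal_theory_restr S : S `<=` Lit KB -> theory KB `|` restr KB S = set0.
Proof.
move=> SL; have [-> _] := KB_normal; rewrite set0U; apply/seteqP; split=> // l [Sl].
rewrite normal_Omega.
(* A literal contains a predicate symbol, so its [pred_occ] is not included in the empty set. *)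
by case: (SL _ Sl) => [/HB_is_atom[P [ts ->]]|[_ /HB_is_atom[P [ts ->]] <-]];
  apply; reflexivity.
Qed.

Lemma normal_not_entails S A : S `<=` Lit KB -> HB KB A -> ~ KB_entails KB S A.
Proof.
by move=> SL /HB_is_atom; rewrite /KB_entails normal_theory_restr//; exact: not_entails0_atom.
Qed.

Lemma normal_Z_KB I : I `<=` Lit KB -> Z_KB KB I = set0.
Proof.
move=> IL; apply/seteqP; split=> // A [/HB_is_atom].
by rewrite /KB_entails normal_theory_restr//; exact: not_entails0_Not_atom.
Qed.

Lemma normal_KB_consistent I : I `<=` Lit KB -> KB_consistent KB I <-> consistent I.
Proof.
move=> IL; rewrite /KB_consistent normal_theory_restr//; split=> [[]//|cI].
by split=> //; exact: satisfiable0.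
Qed.

Lemma normal_body_ordinary r A :
  rules KB r -> pos r A \/ neg r A -> ordinary KB A.
Proof. by have [_ ord] := KB_normal; move=> /ord[_]; exact. Qed.

Lemma normal_T_KB I : I `<=` Lit KB -> consistent I -> T_KB KB I = std_T (rules KB) I.
Proof.
move=> IL cI; have KI := (normal_KB_consistent IL).2 cI.
apply/seteqP; split=> [A [HA /(_ KI)[[r [Pr hr ord _ _]]|]]|_ [r [Pr rI] <-]].
- exists r => //; split=> // B [pB|[C nC <-]].
    by apply: (ord B _).1 => //; apply: normal_body_ordinary Pr _; left.
  by apply: (ord C _).2 => //; apply: normal_body_ordinary Pr _; right.
- by move/normal_not_entails => /(_ IL HA).
split=> [|_]; first exact: head_HB.
left; exists r; split=> // [A _|A nA pA|A nA pA].
- by split=> [pA|nA]; apply: rI; [left|right; exists A].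
- by case: nA; apply: normal_body_ordinary Pr _; left.
- by case: nA; apply: normal_body_ordinary Pr _; right.
Qed.

Lemma normal_unfounded I : I `<=` Lit KB -> consistent I ->
  unfounded KB I = std_unfounded (HB KB) (rules KB) I.
Proof.
move=> IL cI; have KI := (normal_KB_consistent IL).2 cI.
apply/seteqP; split=> [U [/(_ KI)[UH uU] _]|U [UH uU]].
  split=> // a r Ua Pr hr; have [/(_ hr) ua _] := uU _ _ Ua Pr.
  case: ua => [[A [_ pA IA]]|[A [_ nA IA]]|[A [nA pA _]]|[A [nA pA _]]].
  - by left; exists A.
  - by right; exists A.
  - by case: nA; apply: normal_body_ordinary Pr _; left.
  - by case: nA; apply: normal_body_ordinary Pr _; right.
split=> [_|/(_ KI)//]; split=> // a r Ua Pr; split=> [hr|S [SL _] _]; last first.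
  by apply: normal_not_entails SL _; exact: UH.
have [[A pA IA]|[A nA IA]] := uU _ _ Ua Pr hr.
- by apply: Or41; exists A; split=> //; apply: normal_body_ordinary Pr _; left.
- by apply: Or42; exists A; split=> //; apply: normal_body_ordinary Pr _; right.
Qed.

Lemma normal_W_KB I : I `<=` Lit KB -> consistent I ->
  W_KB KB I = std_W (HB KB) (rules KB) I.
Proof.
move=> IL cI; rewrite /W_KB normal_Z_KB// /negs image_set0 setU0 normal_T_KB//.
by rewrite /U_KB normal_unfounded.
Qed.

(** By the conventions for the inconsistent case, [T_KB] and [U_KB] are both the whole Herbrand
    base. *)
Lemma inconsistent_W_KB I : ~ KB_consistent KB I -> Lit KB `<=` W_KB KB I.
Proof.
move=> nI; apply: (subset_trans _ (@subsetUl _ _ _)); apply: setUSS => [A HA|].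
  by split=> // /nI.
by apply: image_subset => A HA; exists (HB KB) => //; split=> // /nI.
Qed.

End NormalProgram.

Theorem theorem1 (Lg : language) (KB : fol_program Lg)
    (KB_normal : normal_program KB) :
  exists W : set (formula Lg),
    wfs KB W /\ std_wfs (HB KB) (rules KB) W.
Proof.
have [X [WX minX]] := exists_lfp_on_setT (@std_W_homo _ (HB KB) (rules KB)).
have cX := std_lfp_consistent (@HB_is_atom _ KB) (@head_HB _ KB) WX minX.
have XL : X `<=` Lit KB by rewrite -WX; exact: std_W_sub (@head_HB _ KB) X.
exists X; split; split=> //; first by rewrite normal_W_KB.
  (* [wfs] also ranges over inconsistent fixpoints; such a [Y] contains every literal, hence [X]. *)
  move=> Y YL WY; have [cY|nY] := pselect (consistent Y).
    by apply: minX; rewrite -normal_W_KB// WY.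
  apply: subset_trans XL _; rewrite -WY; apply: inconsistent_W_KB.
  by move/normal_KB_consistent => /(_ KB_normal YL).
by move=> Y _ WY; apply: minX; rewrite WY.
Qed.
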